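(* Let $M$ be a closed connected surface with a triangulation $\mathcal{T}=\{V,E,F\}$, $V=\{1,\dots,N\}$, let $I:E\to[0,+\infty)$ be an inversive distance, and let $\alpha\in\mathbb{R}$. Assume there exists a metric in $\Omega$ with constant $\alpha$-curvature. If $\chi(M)>0$, then $Y\cap\mathbb{R}^N_{>0}\ne\emptyset$; if $\chi(M)<0$, then $Y\cap\mathbb{R}^N_{<0}\neq\emptyset$; if $\chi(M)=0$, then $Y\cap\{0\}\ne\emptyset$.
   Context: $V,E,F$ are the vertices, edges and faces of $\mathcal{T}$, $N=|V|$. For $r\in\mathbb{R}^N_{>0}$ each edge $\{ij\}\in E$ gets length $l_{ij}=\sqrt{r_i^2+r_j^2+2r_ir_jI_{ij}}$. $\Omega$ is the set of all $r\in\mathbb{R}^N_{>0}$ such that for every face $\{ijk\}\in F$ the lengths $l_{ij},l_{jk},l_{ik}$ satisfy the three strict triangle inequalities; elements of $\Omega$ are called (inversive distance circle packing) metrics. For $r\in\Omega$, $\theta_i^{jk}$ is the inner angle at vertex $i$ of the Euclidean triangle $\{ijk\}$ with these edge lengths, and $K_i=2\pi-\sum_{\{ijk\}\in F}\theta_i^{jk}$ (sum over the triangles having $i$ as a vertex). The $\alpha$-curvature at $i$ is $R_{\alpha,i}=K_i/r_i^\alpha$; it is constant if it is the same for all $i\in V$. For nonempty proper $A\subset V$: $F_A$ is the subcomplex of $\mathcal{T}$ consisting of all cells whose vertices are all in $A$, and $\chi(F_A)$ is its Euler characteristic; $Lk(A)$ is the set of pairs $(e,v)$ of an edge $e$ and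 a vertex $v$ such that (1) the end points of $e$ are not in $A$, (2) $v\in A$, (3) $e$ and $v$ form a triangle of $\mathcal{T}$. $\Lambda(x)=\pi$ for $x\le-1$, $\Lambda(x)=\arccos x$ for $-1\le x\le 1$, $\Lambda(x)=0$ for $x\ge1$. Put $Y_A=\{x\in\mathbb{R}^N\mid\sum_{i\in A}x_i>-\sum_{(e,v)\in Lk(A)}(\pi-\Lambda(I_e))+2\pi\chi(F_A)\}$ and $Y=\{x\in\mathbb{R}^N\mid\sum_{i\in V}x_i=2\pi\chi(M)\}\cap\bigcap_{\emptyset\ne A\subsetneq V}Y_A$. $\mathbb{R}^N_{>0}$ and $\mathbb{R}^N_{<0}$ are the sets of vectors with all coordinates positive, respectively negative. *)

(* Defs.v *)
From HB Require Import structures.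
From mathcomp Require Import all_boot all_order all_algebra.
From mathcomp Require Import all_classical all_reals all_analysis.
Set Implicit Arguments.
Unset Strict Implicit.
Unset Printing Implicit Defensive.
Import Order.TTheory GRing.Theory Num.Theory.
Local Open Scope classical_set_scope.
Local Open Scope ring_scope.

(* A graph with vertex set [L] and edge set [EL] is a polygon (a simple closed
   cycle) when its vertices can be listed cyclically, without repetition, so
   that its edges are exactly the pairs of cyclically consecutive vertices. *)
Definition is_polygon (T : finType) (L : {set T}) (EL : {set {set T}}) : Prop :=
  exists c : seq T,
    [/\ uniq c, (3 <= size c)%N, L = [set x in c]%SET
      & EL = [set [set x; next c x]%SET | x in c]%SET].

(* A triangulated closed connected surface: the vertices are 0, ..., N-1, the
   edges and faces are 2- and 3-element sets of vertices.  The underlying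
   space of a finite 2-dimensional simplicial complex is a closed surface iff
   the link of each vertex is a polygon; it is then connected iff it is
   nonempty and its 1-skeleton is a connected graph. *)
Record surface_triangulation (N : nat) : Type := SurfaceTriangulation {
  edges : {set {set 'I_N}};
  faces : {set {set 'I_N}};
  vertices_gt0 : (0 < N)%N;
  card_edge : forall e, e \in edges -> #|e| = 2%N;
  card_face : forall f, f \in faces -> #|f| = 3%N;
  face_closed : forall f e : {set 'I_N},
    f \in faces -> e \subset f -> #|e| = 2%N -> e \in edges;
  vertex_link : forall v : 'I_N,
    is_polygon [set u | [set v; u]%SET \in edges]%SET
               [set (f :\ v)%SET | f in faces & v \in f]%SET;
  surface_connected : forall i j : 'I_N,
    connect (fun a b : 'I_N => [set a; b]%SET \in edges) i j
}.

Section Combinatorics.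
Variables (N : nat) (T : surface_triangulation N).

Definition euler_char (V : {set 'I_N}) (E F : {set {set 'I_N}}) : int :=
  #|V|%:Z - #|E|%:Z + #|F|%:Z.

Definition chi_surface : int := euler_char [set: 'I_N]%SET (edges T) (faces T).

Definition chi_sub (A : {set 'I_N}) : int :=
  euler_char A [set e in edges T | e \subset A]%SET
               [set f in faces T | f \subset A]%SET.

Definition Lk (A : {set 'I_N}) : {set {set 'I_N} * 'I_N} :=
  [set ev : {set 'I_N} * 'I_N |
    [&& ev.1 \in edges T, [disjoint ev.1 & A], ev.2 \in A
      & (ev.2 |: ev.1)%SET \in faces T]]%SET.

End Combinatorics.

Section CirclePacking.
Variables (R : realType) (N : nat) (T : surface_triangulation N).

Definition positive_vectors : set 'rV[R]_N := 
  [set x : 'rV[R]_N | forall i, 0 < x ord0 i].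
Definition negative_vectors : set 'rV[R]_N := 
  [set x : 'rV[R]_N | forall i, x ord0 i < 0].

(* Only the values of [I] on the edges of [T] are ever relevant. *)
Variable I : {set 'I_N} -> R.

Definition edge_length (r : 'rV[R]_N) (i j : 'I_N) : R :=
  Num.sqrt (r ord0 i ^+ 2 + r ord0 j ^+ 2
            + 2 * r ord0 i * r ord0 j * I [set i; j]%SET).

Definition Omega : set 'rV[R]_N :=
  [set r : 'rV[R]_N | positive_vectors r /\
    forall i j k : 'I_N, [set i; j; k]%SET \in faces T ->
      [/\ edge_length r i j < edge_length r j k + edge_length r i k,
          edge_length r j k < edge_length r i j + edge_length r i k
        & edge_length r i k < edge_length r i j + edge_length r j k]].

(* The angle, in a Euclidean triangle, between the sides of lengths [a] and [b],
   the third side having length [c] (law of cosines). *)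
Definition triangle_angle (a b c : R) : R :=
  acos ((a ^+ 2 + b ^+ 2 - c ^+ 2) / (2 * a * b)).

Definition theta (r : 'rV[R]_N) (i j k : 'I_N) : R :=
  triangle_angle (edge_length r i j) (edge_length r i k) (edge_length r j k).

(* The condition [p.1 < p.2] makes each face {i, j, k} at [i] count once. *)
Definition curvature (r : 'rV[R]_N) (i : 'I_N) : R :=
  2 * pi - \sum_(p : 'I_N * 'I_N |
                  (p.1 < p.2)%N && ([set i; p.1; p.2]%SET \in faces T))
              theta r i p.1 p.2.

Definition alpha_curvature (alpha : R) (r : 'rV[R]_N) (i : 'I_N) : R :=
  curvature r i / (r ord0 i `^ alpha).

Definition constant_alpha_curvature (alpha : R) (r : 'rV[R]_N) : Prop :=
  forall i j : 'I_N, alpha_curvature alpha r i = alpha_curvature alpha r j.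

Definition Lambda (x : R) : R :=
  if x <= -1 then pi else if x <= 1 then acos x else 0.

Definition Y_ (A : {set 'I_N}) : set 'rV[R]_N :=
  [set x : 'rV[R]_N | \sum_(i in A) x ord0 i >
           - (\sum_(ev in Lk T A) (pi - Lambda (I ev.1)))
           + 2 * pi * (chi_sub T A)%:~R].

Definition Y : set 'rV[R]_N :=
  [set x : 'rV[R]_N | \sum_(i < N) x ord0 i = 2 * pi * (chi_surface T)%:~R] `&`
  \bigcap_(A in [set A : {set 'I_N} | A != finset.set0 /\ A != [set: 'I_N]%SET]) Y_ A.

End CirclePacking.

(* Main.v *)
Require Import Defs.
From HB Require Import structures.
From mathcomp Require Import all_boot all_order all_algebra.
From mathcomp Require Import all_classical all_reals all_analysis.
From mathcomp Require Import ring lra.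
Set Implicit Arguments.
Unset Strict Implicit.
Unset Printing Implicit Defensive.
Import Order.TTheory GRing.Theory Num.Theory.
Local Open Scope classical_set_scope.
Local Open Scope ring_scope.

(** The witness is the curvature vector K of the given metric r.

    First, K belongs to Y for every metric of Omega when I >= 0. Its coordinates
    add up to 2 pi chi(M) by Gauss-Bonnet ([gauss_bonnet]). For a nonempty
    proper set A of vertices, the sum of K over A is 2 pi #|A| minus, for each
    face, the sum of its angles at the vertices in A. The latter is
    - pi when the three vertices are in A,
    - less than pi when two are,
    - less than pi - Lambda (I e) when only one is, e being the opposite edge
      ([theta_lt_Lambda]); these faces are the elements of Lk(A).
    Every edge lies on exactly two faces ([edge_in_two_faces]), so the number of
    edges inside A is half the sum over the faces of 'C(m, 2), where m counts
    the vertices of the face lying in A ([sum_bin_face]). This turns the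
    combinatorial terms into 2 pi chi(F_A), and the face-by-face inequalities
    ([face_bound_le], [face_bound_lt]) add up to the inequality defining Y_A
    ([curvature_Y_]). It is strict because the surface is connected: some face
    has vertices both in A and outside A ([exists_mixed_face]).

    Secondly, if K_i = c * r_i ^ alpha for all i, then all K_i have the sign
    of c, and by Gauss-Bonnet this is the sign of chi(M). *)

(** * Angles of Euclidean triangles *)

Section EuclideanTriangle.
Variable R : realType.
Implicit Types a b c x y : R.

Lemma acos_lt x y : -1 <= x -> y <= 1 -> x < y -> acos y < acos x.
Proof.
move=> x_ge y_le xy.
have xB : -1 <= x <= 1 by apply/andP; split; lra.
have yB : -1 <= y <= 1 by apply/andP; split; lra.
rewrite -ltr_cos ?in_itv/= ?acos_ge0 ?acos_lepi//.
by rewrite !acosK ?in_itv.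
Qed.

Definition triangle_cos a b c := (a ^+ 2 + b ^+ 2 - c ^+ 2) / (2 * a * b).

Definition triangle_sides a b c := [/\ a < b + c, b < a + c & c < a + b].

Lemma triangle_sides_gt0 a b c :
  triangle_sides a b c -> [/\ 0 < a, 0 < b & 0 < c].
Proof. by case=> abc bac cab; split; lra. Qed.

Lemma triangle_cos_bound a b c :
  triangle_sides a b c -> -1 < triangle_cos a b c < 1.
Proof.
move=> abcT; have [a0 b0 _] := triangle_sides_gt0 abcT.
case: abcT => abc bac cab.
have ab0 : 0 < 2 * a * b by rewrite !mulr_gt0.
rewrite /triangle_cos ltr_pdivlMr// ltr_pdivrMr//.
by apply/andP; split; nra.
Qed.

Lemma triangle_angle_gt0 a b c :
  triangle_sides a b c -> 0 < triangle_angle a b c.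
Proof.
move=> /triangle_cos_bound/andP[xN1 x1].
by apply: acos_gt0; rewrite -/(triangle_cos a b c) (ltW xN1) x1.
Qed.

Lemma triangle_angleC a b c : triangle_angle a b c = triangle_angle b a c.
Proof. by congr (acos (_ / _)); ring. Qed.

(** If x, y, z are the cosines of the three angles, cos (acos x + acos y) = - z
    is the cosine of pi - acos z. The sum acos x + acos y is less than pi since
    x > - y, and cos is injective on [0, pi]. *)
Lemma triangle_angle_sum a b c : triangle_sides a b c ->
  triangle_angle b c a + triangle_angle a c b + triangle_angle a b c = pi.
Proof.
move=> abcT; have [a0 b0 c0] := triangle_sides_gt0 abcT.
case: (abcT) => abc bac cab.
set x := triangle_cos b c a; set y := triangle_cos a c b.
set z := triangle_cos a b c.
have xI : -1 < x < 1 by apply: triangle_cos_bound; split; lra.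
have yI : -1 < y < 1 by apply: triangle_cos_bound; split; lra.
have zI : -1 < z < 1 by exact: triangle_cos_bound.
have xB : -1 <= x <= 1 by move/andP: xI => [/ltW -> /ltW ->].
have yB : -1 <= y <= 1 by move/andP: yI => [/ltW -> /ltW ->].
have zB : -1 <= z <= 1 by move/andP: zI => [/ltW -> /ltW ->].
change (acos x + acos y + acos z = pi).
have [an0 bn0 cn0] : [/\ a != 0, b != 0 & c != 0] by rewrite !gt_eqF.
(* by Heron's formula, S is sixteen times the square of the area *)
pose S := (a + b + c) * (b + c - a) * (a + c - b) * (a + b - c).
have S0 : 0 < S by rewrite !mulr_gt0//; lra.
have xy0 : - y < x.
  rewrite -subr_gt0 opprK.
  have -> : x + y = (a + b) * (c + a - b) * (c + b - a) / (2 * a * b * c).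
    by rewrite /x /y /triangle_cos; field; rewrite an0 bn0 cn0.
  by rewrite divr_gt0 ?mulr_gt0//; lra.
have sum_le : acos x + acos y < pi.
  rewrite -ltrBrDr -acosN//; apply: acos_lt => //; last by lra.
  by rewrite lerN2; case/andP: yB.
have sin_sinE : sin (acos x) * sin (acos y) = S / (4 * a * b * c ^+ 2).
  rewrite !sin_acos// -sqrtrM; last by move/andP: xB => []; nra.
  have -> : (1 - x ^+ 2) * (1 - y ^+ 2) = (S / (4 * a * b * c ^+ 2)) ^+ 2.
    by rewrite /x /y /S /triangle_cos; field; rewrite an0 bn0 cn0.
  rewrite sqrtr_sqr ger0_norm// divr_ge0 ?(ltW S0)// ltW//.
  by rewrite !mulr_gt0// exprn_gt0.
have cosE : cos (acos x + acos y) = - z.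
  rewrite cosD sin_sinE !acosK ?in_itv//.
  by rewrite /x /y /z /S /triangle_cos; field; rewrite an0 bn0 cn0.
have {cosE} : acos (cos (acos x + acos y)) = acos (- z) by rewrite cosE.
rewrite acosN// cosK ?in_itv/=; first by move=> ->; ring.
by rewrite addr_ge0 ?acos_ge0// ltW.
Qed.

Lemma Lambda_le_pi x : Lambda x <= pi.
Proof.
rewrite /Lambda; case: ifPn => //; rewrite -ltNge => xN1.
case: ifPn => x1; last exact: pi_ge0.
by apply: acos_lepi; rewrite (ltW xN1).
Qed.

(** For x < 1 the right-hand side is acos (- x), so the claim is that acos is
    decreasing; for x > 1 it is pi, and the triangle is nondegenerate. *)
Lemma triangle_angle_lt_Lambda a b c x :
  triangle_sides a b c -> - x < triangle_cos a b c ->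
  triangle_angle a b c < pi - Lambda x.
Proof.
move=> abcT x_lt; have /andP[zN1 z1] := triangle_cos_bound abcT.
rewrite /Lambda; case: ifPn => [xN1|]; first by exfalso; lra.
rewrite -ltNge => xN1; case: ifPn => [x1|_].
  by rewrite -acosN ?(ltW xN1)//; apply: acos_lt; rewrite ?lerN2// ltW.
rewrite subr0; apply: acos_ltpi.
by rewrite -/(triangle_cos a b c) zN1 ltW.
Qed.

End EuclideanTriangle.

(** * Counting faces of a triangulated surface *)

Lemma next_neq_prev (U : finType) (c : seq U) (u : U) :
  uniq c -> (3 <= size c)%N -> u \in c -> next c u != prev c u.
Proof.
move=> c_uniq c3 uc; apply: contraTneq uc => /(congr1 (next c)).
rewrite next_prev// => nextK; apply/negP => /rot_to[i s rotE].
move: nextK (c_uniq) c3; rewrite -!(next_rot i c_uniq).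
rewrite -(size_rot i) -(rot_uniq i) rotE; case: s {rotE} => [|a [|b s]]//=.
rewrite eqxx !inE !negb_or; case: (eqVneq a u) => //= _.
by rewrite eqxx => ->; rewrite eqxx.
Qed.

Section Counting.
Variables (N : nat) (T : surface_triangulation N).
Implicit Types (A e f : {set 'I_N}) (u v : 'I_N).

(** In the link of one end point v of e, which is a polygon, the faces that
    contain e are the two sides at the other end point u: the ones joining u to
    its successor and to its predecessor. *)
Lemma edge_in_two_faces e :
  e \in edges T -> #|[set f in faces T | e \subset f]%SET| = 2%N.
Proof.
move=> eE; have /eqP/cards2P[v [u [vu def_e]]] := card_edge eE.
have [c [c_uniq c3 defL defEL]] := vertex_link T v.
have uc : u \in c.
  by move: eE; rewrite def_e => vuE; move/setP/(_ u): defL; rewrite !inE vuE.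
have -> : [set f in faces T | e \subset f]%SET =
          [set f in [set f in faces T | v \in f] | u \in f]%SET.
  by apply/setP => f; rewrite !inE def_e finset.subUset !finset.sub1set andbA.
have rem_inj : {in [set f in [set f in faces T | v \in f] | u \in f]%SET &,
                injective (fun f => f :\ v)%SET}.
  move=> f g; rewrite !inE => /andP[/andP[_ vf] _] /andP[/andP[_ vg] _] fg.
  by rewrite -(finset.setD1K vf) fg finset.setD1K.
rewrite -(card_in_imset rem_inj).
have -> : [set (f :\ v)%SET |
              f in [set f in [set f in faces T | v \in f] | u \in f]%SET]%SET
          = [set [set u; next c u]; [set prev c u; u]]%SET.
  apply/setP => l; apply/imsetP/idP => [[f]|].
    rewrite !inE => /andP[/andP[fF vf] uf] ->.
    have : (f :\ v)%SET \in [set [set x; next c x]%SET | x in c]%SET.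
      by rewrite -defEL; apply/imsetP; exists f; rewrite // inE fF.
    case/imsetP => x xc fv; have : u \in (f :\ v)%SET by rewrite !inE eq_sym vu.
    rewrite fv !inE => /orP[/eqP<-|/eqP uE]; first by rewrite eqxx.
    by rewrite [in [set prev c u; u]%SET]uE prev_next// -uE eqxx orbT.
  have link l' : l' \in [set [set x; next c x]%SET | x in c]%SET -> u \in l' ->
      exists2 f, f \in [set f in [set f in faces T | v \in f] | u \in f]%SET
               & l' = (f :\ v)%SET.
    rewrite -defEL => /imsetP[f fF ->]; rewrite !inE => /andP[_ uf].
    by exists f => //; rewrite !inE uf andbT; move: fF; rewrite inE.
  rewrite !inE => /orP[/eqP->|/eqP->]; apply: link; rewrite ?inE ?eqxx ?orbT//.
    by apply/imsetP; exists u.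
  by apply/imsetP; exists (prev c u); rewrite ?mem_prev ?next_prev.
rewrite cards2; case: eqVneq => //= /setP/(_ (next c u)).
have := next_neq_prev c_uniq c3 uc; rewrite !inE eqxx orbT => /negPf->.
move=> /esym/= /eqP nextu; move: (next_neq_prev c_uniq c3 uc).
by rewrite -[in prev c u]nextu prev_next// nextu eqxx.
Qed.

(** Both sides count the pairs of an edge inside A and a face containing it: a
    face with m vertices in A has 'C(m, 2) edges inside A. *)
Lemma sum_bin_face A :
  (\sum_(f in faces T) 'C(#|f :&: A|%SET, 2) =
   2 * #|[set e in edges T | e \subset A]%SET|)%N.
Proof.
transitivity (\sum_(f in faces T)
    \sum_(e in [set e in edges T | e \subset A]%SET | e \subset f) 1)%N.
  apply: eq_bigr => f fF; rewrite -cards_draws sum1dep_card.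
  apply: eq_card => e; rewrite !inE finset.subsetI.
  case: (boolP (e \subset f)) => ef; rewrite ?andbF//= andbT.
  rewrite andbC; congr andb; apply/eqP/idP => [e2|/card_edge//].
  exact: face_closed fF ef e2.
rewrite (exchange_big_dep (mem [set e in edges T | e \subset A]%SET))/=;
  last first.
  by move=> f e _ /andP[].
rewrite mulnC -sum_nat_const; apply: eq_bigr => e; rewrite !inE => /andP[eE eA].
rewrite -(edge_in_two_faces eE) sum1dep_card; apply: eq_card => f.
by rewrite !inE eE eA.
Qed.

Lemma sum_face_subset A :
  (\sum_(f in faces T) (f \subset A) =
   #|[set f in faces T | f \subset A]%SET|)%N.
Proof.
by rewrite -sum1dep_card [RHS]big_mkcondr; apply: eq_bigr => f _; case: ifP.
Qed.

(** By connectedness some edge leaves A; any face containing it will do. *)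
Lemma exists_mixed_face A : A != finset.set0 -> A != [set: 'I_N]%SET ->
  exists2 f, f \in faces T & (0 < #|(f :&: A)%SET| < 3)%N.
Proof.
move=> /set0Pn[a aA]; rewrite -finset.subTset => /subsetPn[b _ bA].
have [e eE] : exists2 e, e \in edges T &
    [exists x, exists y, [&& x \in e, y \in e, x \in A & y \notin A]].
  case: (boolP [exists e in edges T,
      [exists x, exists y, [&& x \in e, y \in e, x \in A & y \notin A]]]).
    by case/exists_inP => e eE He; exists e.
  move=> /exists_inPn noE.
  have clA : fingraph.closed (fun x y : 'I_N => [set x; y]%SET \in edges T) A.
    move=> x y xyE; have /existsPn no := noE _ xyE.
    have /existsPn/(_ y) := no x; have /existsPn/(_ x) := no y.
    by rewrite !inE !eqxx !orbT/=; case: (x \in A); case: (y \in A).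
  have := closed_connect clA (surface_connected T a b).
  by rewrite aA (negPf bA).
move=> /existsP[x /existsP[y /and4P[xe ye xA yA]]].
have /card_gt0P[f] : (0 < #|[set f in faces T | e \subset f]%SET|)%N.
  by rewrite edge_in_two_faces.
rewrite inE => /andP[fF /fintype.subsetP ef]; exists f => //; apply/andP; split.
  by apply/card_gt0P; exists x; rewrite inE ef.
rewrite -(card_face fF); apply: proper_card; apply/properP; split.
  exact: finset.subsetIl.
by exists y; rewrite ?ef// inE (negPf yA) andbF.
Qed.

End Counting.

(** * The curvature of a circle packing metric *)

Section Packing.
Variables (R : realType) (N : nat) (T : surface_triangulation N).
Variable I : {set 'I_N} -> R.
Hypothesis I_ge0 : forall e, e \in edges T -> 0 <= I e.
Variable r : 'rV[R]_N.
Hypothesis r_Omega : Omega T I r.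
Implicit Types (A e f : {set 'I_N}) (i j k v : 'I_N).

Local Notation len := (edge_length I r).

Lemma edge_lengthC i j : len i j = len j i.
Proof. by rewrite /edge_length finset.setUC; congr Num.sqrt; ring. Qed.

Lemma thetaC i j k : theta I r i j k = theta I r i k j.
Proof. by rewrite /theta triangle_angleC (edge_lengthC j). Qed.

Lemma face_sides i j k : [set i; j; k]%SET \in faces T ->
  triangle_sides (len i j) (len i k) (len j k).
Proof. by case: r_Omega => _ /[apply] -[? ? ?]; split; lra. Qed.

Lemma face_edges i j k : [set i; j; k]%SET \in faces T ->
  [/\ [set i; j]%SET \in edges T, [set i; k]%SET \in edges T
    & [set j; k]%SET \in edges T].
Proof.
move=> ijkF; have edge a b :
    a \in [set i; j; k]%SET -> b \in [set i; j; k]%SET -> a != b ->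
    [set a; b]%SET \in edges T.
  move=> af bf ab; apply: (face_closed ijkF); last by rewrite cards2 ab.
  by rewrite finset.subUset !finset.sub1set af bf.
have := card_face ijkF; rewrite finset.setUC cardsU1 cards2 !inE.
case: (eqVneq k i) => [//|ki]; first by case: (i != j).
case: (eqVneq k j) => [//|kj]; first by case: (i != j).
case: (eqVneq i j) => // ij _.
by split; apply: edge; rewrite ?inE ?eqxx ?orbT// eq_sym.
Qed.

(** By the law of cosines, cos (theta i j k) > - w, where w = I jk, amounts to
    r_i^2 + r_i r_j u + r_i r_k v + (l_ij l_ik - r_j r_k) w > 0 with u = I ij
    and v = I ik. Since inversive distances are nonnegative, l_ij >= r_j and
    l_ik >= r_k, so the first term is positive and no other one is negative. *)
Lemma theta_lt_Lambda i j k : [set i; j; k]%SET \in faces T ->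
  theta I r i j k < pi - Lambda (I [set j; k]%SET).
Proof.
move=> ijkF; have sides := face_sides ijkF.
have [ijE ikE jkE] := face_edges ijkF.
have r0 v : 0 < r ord0 v by case: r_Omega => + _; apply.
have cross_ge0 a b : [set a; b]%SET \in edges T ->
    0 <= 2 * r ord0 a * r ord0 b * I [set a; b]%SET.
  by move=> abE; rewrite !mulr_ge0 ?I_ge0// ltW.
have sqrE a b : [set a; b]%SET \in edges T -> len a b ^+ 2 =
    r ord0 a ^+ 2 + r ord0 b ^+ 2 + 2 * r ord0 a * r ord0 b * I [set a; b]%SET.
  by move=> abE; rewrite sqr_sqrtr// !addr_ge0 ?sqr_ge0 ?cross_ge0.
have r_le a b : [set a; b]%SET \in edges T -> r ord0 b <= len a b.
  move=> abE; rewrite -ler_sqr ?nnegrE ?sqrtr_ge0 ?(ltW (r0 _))// sqrE//.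
  by rewrite addrAC lerDr addr_ge0 ?sqr_ge0 ?cross_ge0.
apply: triangle_angle_lt_Lambda => //.
have [ij0 ik0 _] := triangle_sides_gt0 sides.
rewrite /triangle_cos ltr_pdivlMr ?mulr_gt0// !sqrE//.
have := r_le _ _ ijE; have := r_le _ _ ikE.
have := I_ge0 ijE; have := I_ge0 ikE; have := I_ge0 jkE.
have := r0 i; have := r0 j; have := r0 k.
move: ij0 ik0; set a := len i j; set b := len i k; set ri := r _ i.
set rj := r _ j; set rk := r _ k.
set w := I [set j; k]%SET; set v := I [set i; k]%SET; set u := I [set i; j]%SET.
move=> a0 b0 rk0 rj0 ri0 w0 v0 u0 rkb rja.
have prod_le : rj * rk * w <= a * b * w.
  by rewrite ler_wpM2r// ler_pM// ltW.
have : 0 < ri ^+ 2 by rewrite exprn_gt0.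
have : 0 <= ri * rj * u by rewrite !mulr_ge0// ltW.
have : 0 <= ri * rk * v by rewrite !mulr_ge0// ltW.
by lra.
Qed.

(** The angle of the face f at its vertex i. The sum has a single term; it
    selects the two other vertices in the order used by [curvature]. *)
Definition face_angle f i : R :=
  \sum_(p : 'I_N * 'I_N | (p.1 < p.2)%N && ([set i; p.1; p.2]%SET == f))
    theta I r i p.1 p.2.

Lemma face_angleE i j k : i != j -> i != k -> j != k ->
  face_angle [set i; j; k]%SET i = theta I r i j k.
Proof.
wlog jk : j k / (j < k)%N => [wlogH ij ik jk|ij ik jk'].
  have [lt_jk|] := ltnP j k; first exact: wlogH.
  rewrite leq_eqVlt val_eqE eq_sym (negPf jk)/= => lt_kj.
  rewrite thetaC -finset.setUA (finset.setUC [set j]%SET) finset.setUA.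
  by rewrite wlogH// eq_sym.
rewrite /face_angle (big_pred1 (j, k))// => -[a b]/=.
apply/andP/eqP => [[ab /eqP/setP fE]|[-> ->]]; last by rewrite jk eqxx.
have := fE j; have := fE k; rewrite !inE !eqxx !orbT/= ![_ == i]eq_sym.
rewrite (negPf ij) (negPf ik)/= => /orP[]/eqP ? /orP[]/eqP ?; subst=> //.
- by rewrite eqxx in jk'.
- by have := ltn_trans ab jk; rewrite ltnn.
- by rewrite eqxx in jk'.
Qed.

Lemma face_split f v : f \in faces T -> v \in f ->
  exists j k, [/\ f = [set v; j; k]%SET, v != j, v != k & j != k].
Proof.
move=> fF vf; have /eqP := card_face fF; rewrite (cardsD1 v) vf add1n eqSS.
move=> /cards2P[j [k [jk fv]]]; exists j, k.
have : v \notin (f :\ v)%SET by rewrite !inE eqxx.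
rewrite fv !inE negb_or => /andP[vj vk]; split=> //.
by rewrite -finset.setUA -fv finset.setD1K.
Qed.

Lemma face_angle_gt0 f v : f \in faces T -> v \in f -> 0 < face_angle f v.
Proof.
move=> fF vf; have [j [k [fE vj vk jk]]] := face_split fF vf.
rewrite fE face_angleE//; apply: triangle_angle_gt0.
by apply: face_sides; rewrite -fE.
Qed.

Lemma face_angle_lt f v : f \in faces T -> v \in f ->
  face_angle f v < pi - Lambda (I (f :\ v)%SET).
Proof.
move=> fF vf; have [j [k [fE vj vk jk]]] := face_split fF vf.
have -> : (f :\ v)%SET = [set j; k]%SET.
  by rewrite fE -finset.setUA setU1K// !inE negb_or vj.
by rewrite fE face_angleE//; apply: theta_lt_Lambda; rewrite -fE.
Qed.

Lemma face_angle_sum f : f \in faces T -> \sum_(v in f) face_angle f v = pi.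
Proof.
move=> fF; have /card_gt0P[i if_] : (0 < #|f|)%N by rewrite (card_face fF).
have [j [k [fE ij ik jk]]] := face_split fF if_.
have rot a b c : [set a; b; c]%SET = [set b; c; a]%SET :> {set 'I_N}.
  by rewrite -finset.setUA finset.setUC.
rewrite {1}fE -finset.setUA big_setU1 ?inE ?negb_or ?ij//=.
rewrite big_setU1 ?inE//= big_set1.
rewrite {1}fE face_angleE// {1}fE rot face_angleE 1?[_ == i]eq_sym//.
rewrite fE -rot face_angleE 1?[k == _]eq_sym// !/(theta _ _ _ _ _).
rewrite (edge_lengthC j i) (edge_lengthC k i) (edge_lengthC k j).
rewrite fE in fF; rewrite -(triangle_angle_sum (face_sides fF)).
rewrite (triangle_angleC (len j k)) (triangle_angleC (len i k) (len j k)).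
ring.
Qed.

Lemma curvatureE i : curvature T I r i =
  2 * pi - \sum_(f in faces T | i \in f) face_angle f i.
Proof.
rewrite /curvature; congr (_ - _).
rewrite (partition_big (fun p : 'I_N * 'I_N => [set i; p.1; p.2]%SET)
          (fun f : {set 'I_N} => (f \in faces T) && (i \in f)))/=; last first.
  by move=> p /andP[_ ->]; rewrite !inE eqxx.
apply: eq_bigr => f /andP[fF _]; apply: eq_bigl => p.
by case: eqVneq => [->|]; rewrite ?andbF// fF andbT.
Qed.

Lemma sum_curvature A : \sum_(i in A) curvature T I r i =
  2 * pi * #|A|%:R - \sum_(f in faces T) \sum_(i in f :&: A) face_angle f i.
Proof.
under eq_bigr => i _ do rewrite curvatureE.
rewrite big_split/= sumrN sumr_const mulr_natr; congr (_ - _).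
rewrite (exchange_big_dep (fun f : {set 'I_N} => f \in faces T))/=; last first.
  by move=> i f _ /andP[].
by apply: eq_bigr => f fF; apply: eq_bigl => i; rewrite inE fF andbC.
Qed.

(** Each pair (e, v) of Lk(A) is charged to the face that e and v form. *)
Lemma sum_Lk A (F : {set 'I_N} * 'I_N -> R) :
  \sum_(ev in Lk T A) F ev =
  \sum_(f in faces T) \sum_(ev in Lk T A | (ev.2 |: ev.1)%SET == f) F ev.
Proof.
by apply: partition_big => ev; rewrite inE => /and4P[].
Qed.

Local Notation Lk_face A f :=
  (\sum_(ev in Lk T A | (ev.2 |: ev.1)%SET == f) (pi - Lambda (I ev.1))).

Lemma Lk_face_ge0 A f : 0 <= Lk_face A f.
Proof. by apply: sumr_ge0 => ev _; rewrite subr_ge0 Lambda_le_pi. Qed.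

(** The coefficient of pi adds up over the faces to twice the number of edges
    inside A minus twice the number of faces inside A. On a face with m
    vertices in A it is 0, 0, 1, 1 for m = 0, 1, 2, 3. When m = 1 the bound
    comes from the pair of Lk(A) formed by that vertex and the opposite edge,
    when m = 2 from the angle sum pi, the angle outside A being positive. *)
Lemma face_bound_lt A f : f \in faces T -> (0 < #|f :&: A|%SET < 3)%N ->
  \sum_(i in f :&: A) face_angle f i <
    Lk_face A f + pi * ('C(#|f :&: A|%SET, 2)%:R - 2 * (f \subset A)%:R).
Proof.
move=> fF mixed.
have fNA : f \subset A = false.
  apply: contraTF mixed => /finset.setIidPl ->.
  by rewrite (card_face fF) ltnn andbF.
rewrite fNA mulr0 subr0.
have /orP[/cards1P[v fA]|/eqP fA2] :
    (#|f :&: A|%SET == 1%N) || (#|f :&: A|%SET == 2%N).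
  by move: mixed; case: #|_| => [|[|[|]]].
- have /setIP[vf vA] : v \in (f :&: A)%SET by rewrite fA inE.
  rewrite fA cards1 mulr0 addr0 big_set1.
  rewrite (bigD1 ((f :\ v)%SET, v))/=; last first.
    rewrite inE /= vA finset.setD1K// fF eqxx !andbT; apply/andP; split.
      apply: (face_closed fF); first exact: finset.subD1set.
      by move: (card_face fF); rewrite (cardsD1 v) vf => -[].
    rewrite -setI_eq0; apply/eqP/setP => x; rewrite !inE.
    by have /setP/(_ x) := fA; rewrite !inE -andbA => ->; rewrite andNb.
  rewrite ltr_wpDr ?face_angle_lt//.
  by apply: sumr_ge0 => ev _; rewrite subr_ge0 Lambda_le_pi.
- rewrite fA2 mulr1 ltr_wpDl ?Lk_face_ge0//.
  rewrite -(face_angle_sum fF) [ltRHS](big_setID A)/= ltrDl.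
  have /card_gt0P[v vfA] : (0 < #|f :\: A|%SET)%N.
    by rewrite cardsD fA2 (card_face fF).
  rewrite (bigD1 v)//= ltr_wpDr//.
    by apply: sumr_ge0 => u /andP[/setDP[uf _] _]; rewrite ltW// face_angle_gt0.
  by case/setDP: vfA => vf _; apply: face_angle_gt0.
Qed.

Lemma face_bound_le A f : f \in faces T ->
  \sum_(i in f :&: A) face_angle f i <=
    Lk_face A f + pi * ('C(#|f :&: A|%SET, 2)%:R - 2 * (f \subset A)%:R).
Proof.
move=> fF; case: (boolP (0 < #|f :&: A|%SET < 3)%N) => [?|].
  exact/ltW/face_bound_lt.
rewrite negb_and -leqNgt -ltnNge leqn0 cards_eq0 => /orP[/eqP fA0|fA3].
  have fNA : f \subset A = false.
    apply/negP => /finset.setIidPl; rewrite fA0 => f0.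
    by have := card_face fF; rewrite -f0 cards0.
  by rewrite fA0 big_set0 cards0 fNA mulr0 subr0 mulr0 addr0 Lk_face_ge0.
have /eqP fA : (f :&: A)%SET == f.
  by rewrite eqEcard finset.subsetIl (card_face fF).
have -> : f \subset A by apply/finset.setIidPl.
rewrite fA (card_face fF) face_angle_sum// ler_wpDl ?Lk_face_ge0//.
by rewrite (_ : 'C(3, 2) = 3%N)// [X in pi * X](_ : _ = 1) ?mulr1//=; ring.
Qed.

(** The sum of K over A exceeds the bound defining Y_A by the total slack of the
    face inequalities. *)
Lemma sum_curvature_defect A :
  \sum_(i in A) curvature T I r i =
    - \sum_(ev in Lk T A) (pi - Lambda (I ev.1)) + 2 * pi * (chi_sub T A)%:~R
    + \sum_(f in faces T)
        (Lk_face A f + pi * ('C(#|f :&: A|%SET, 2)%:R - 2 * (f \subset A)%:R)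
         - \sum_(i in f :&: A) face_angle f i).
Proof.
rewrite sum_curvature sum_Lk big_split/= sumrN big_split/= -mulr_sumr.
rewrite big_split/= sumrN -mulr_sumr -!natr_sum sum_bin_face sum_face_subset.
rewrite natrM /chi_sub /euler_char intrD intrB -!pmulrn.
ring.
Qed.

Lemma curvature_Y_ A : A != finset.set0 -> A != [set: 'I_N]%SET ->
  Y_ T I A (\row_i curvature T I r i).
Proof.
move=> A0 AT; have [f fF mixed] := exists_mixed_face T A0 AT.
rewrite /Y_/= [ltRHS](eq_bigr (curvature T I r)); last first.
  by move=> i _; rewrite mxE.
rewrite sum_curvature_defect ltrDl (bigD1 f)//= ltr_wpDr//.
  by apply: sumr_ge0 => g /andP[gF _]; rewrite subr_ge0 face_bound_le.
by rewrite subr_gt0 face_bound_lt.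
Qed.

(** The angles of all faces add up to pi per face, and 3F = 2E since every edge
    lies on two faces. *)
Lemma gauss_bonnet :
  \sum_(i < N) curvature T I r i = 2 * pi * (chi_surface T)%:~R.
Proof.
have := sum_curvature [set: 'I_N]%SET; rewrite (eq_bigl predT); last first.
  by move=> i; rewrite inE.
move=> ->; rewrite /chi_surface /euler_char.
rewrite (eq_bigr (fun=> pi)) => [|f fF]; last first.
  by rewrite finset.setIT face_angle_sum.
have edgesE : (3 * #|faces T| = 2 * #|edges T|)%N.
  have := sum_bin_face T [set: 'I_N]%SET.
  rewrite (eq_bigr (fun=> 3%N)) => [|f fF]; last first.
    by rewrite finset.setIT (card_face fF).
  rewrite sum_nat_const mulnC => ->; congr (2 * _)%N.
  by apply: eq_card => e; rewrite inE finset.subsetT andbT.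
have {}edgesE : 3 * #|faces T|%:R = 2 * #|edges T|%:R :> R.
  by rewrite -!natrM edgesE.
rewrite sumr_const -mulr_natr intrD intrB -!pmulrn.
by have := congr1 ( *%R pi) edgesE; lra.
Qed.

Lemma curvature_Y : Y T I (\row_i curvature T I r i).
Proof.
split; last by move=> A [/= A0 AT]; apply: curvature_Y_.
by rewrite /=; under eq_bigr do rewrite mxE; exact: gauss_bonnet.
Qed.

End Packing.

Theorem corollary7p4 (R : realType) (N : nat) (T : surface_triangulation N)
    (I : {set 'I_N} -> R) (I_ge0 : forall e, e \in edges T -> 0 <= I e)
    (alpha : R)
    (exists_constant : exists r : 'rV[R]_N,
        Omega T I r /\ constant_alpha_curvature T I alpha r) :
  [/\ chi_surface T > 0 -> Y T I `&` @positive_vectors R N !=set0,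
      chi_surface T < 0 -> Y T I `&` @negative_vectors R N !=set0
    & chi_surface T = 0 -> Y T I `&` [set 0] !=set0].
Proof.
have [r [r_Omega const]] := exists_constant.
have KY := curvature_Y I_ge0 r_Omega.
have GB := gauss_bonnet r_Omega.
set K := \row_i curvature T I r i in KY.
pose i0 := Ordinal (vertices_gt0 T).
pose c := alpha_curvature T I alpha r i0.
have rpos i : 0 < r ord0 i `^ alpha by rewrite powR_gt0; case: r_Omega.
have KE i : curvature T I r i = c * r ord0 i `^ alpha.
  by rewrite /c (const i0 i) mulfVK// gt_eqF.
pose s : R := \sum_(i < N) r ord0 i `^ alpha.
have s0 : 0 < s.
  by rewrite /s (bigD1 i0)//= ltr_wpDr// sumr_ge0// => i _; rewrite ltW.
have {}GB : c * s = 2 * pi * (chi_surface T)%:~R.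
  by rewrite -GB mulr_sumr; apply: eq_bigr => i _; rewrite KE.
have pi2 : 0 < 2 * pi :> R by rewrite mulr_gt0 ?pi_gt0.
split=> chi.
- have c0 : 0 < c by rewrite -(pmulr_lgt0 _ s0) GB mulr_gt0// ltr0z.
  by exists K; split=> // i; rewrite mxE KE mulr_gt0.
- have c0 : c < 0 by rewrite -(pmulr_llt0 _ s0) GB pmulr_rlt0// ltrz0.
  by exists K; split=> // i; rewrite mxE KE pmulr_llt0.
- have c0 : c = 0.
    by apply/eqP; move/eqP: GB; rewrite chi mulr0 mulf_eq0 (gt_eqF s0) orbF.
  by exists K; split=> //=; apply/rowP => i; rewrite !mxE KE c0 mul0r.
Qed.
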